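(* Consider nearest-center assignment in $\mathbb{R}^2$ with the two fixed centers $c_1=(-1,0)$ and $c_2=(1,0)$. For any $\varepsilon>0$ and any integer $m\ge1$, there exist a configuration $X$ (a finite tuple of points of $\mathbb{R}^2$) and a perturbation $X'$ (a tuple of the same length) with $\|X-X'\|\le\varepsilon$ such that at least $m$ indices change their assigned centers, and the induced partitions differ: $A(X')\ne A(X)$.
   Context: $\|\cdot\|$ on $\mathbb{R}^2$ is the Euclidean norm; configurations are ordered tuples $X=(x_1,\dots,x_n)$, $X'=(x_1',\dots,x_n')$ in $(\mathbb{R}^2)^n$ with $n\ge2$, and $\|X-X'\|=\max_{1\le i\le n}\|x_i-x_i'\|$. Nearest-center assignment with a deterministic tie-breaking rule: a fixed function $\ell:\mathbb{R}^2\to\{1,2\}$ with $\|x-c_{\ell(x)}\|\le\|x-c_j\|$ for all $x$ and $j=1,2$; the point $x$ is assigned to $c_{\ell(x)}$. The induced partition $A(X)$ of $[n]=\{1,\dots,n\}$ is the one in which $i,j$ lie in the same block if and only if $\ell(x_i)=\ell(x_j)$. Index $i$ changes its assigned center if $\ell(x_i')\ne\ell(x_i)$. *)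

(* Defs.v *)
From HB Require Import structures.
From mathcomp Require Import all_boot all_order all_algebra.
From mathcomp Require Import reals.

Set Implicit Arguments.
Unset Strict Implicit.
Unset Printing Implicit Defensive.

Import Order.TTheory GRing.Theory Num.Theory.
Local Open Scope ring_scope.

(* The norm that MathComp-Analysis puts on ['rV[R]_2] is the sup norm, hence
   this explicit Euclidean norm. *)
Definition enorm (R : realType) (x : 'rV[R]_2) : R :=
  Num.sqrt (\sum_(j < 2) x 0 j ^+ 2).

Definition config (R : realType) (n : nat) := {ffun 'I_n -> 'rV[R]_2}.

(* The default value 0 of the iterated maximum is harmless: all terms are
   nonnegative. *)
Definition config_dist (R : realType) (n : nat) (X X' : config R n) : R :=
  \big[Num.max/0]_(i < n) enorm (X i - X' i).

(* The labels 1 and 2 are encoded as [0 : 'I_2] and [1 : 'I_2]: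
   [center R 0 = (-1, 0)] and [center R 1 = (1, 0)]. *)
Definition center (R : realType) (k : 'I_2) : 'rV[R]_2 :=
  \row_(j < 2) (if j == 0 then (if k == 0 then -1 else 1) else 0).

(* Nearest-center assignment with its (arbitrary but fixed) tie-breaking. *)
Definition nearest_center (R : realType) (l : 'rV[R]_2 -> 'I_2) : Prop :=
  forall (x : 'rV[R]_2) (j : 'I_2),
    enorm (x - center R (l x)) <= enorm (x - center R j).

Definition induced_partition (R : realType) (l : 'rV[R]_2 -> 'I_2) (n : nat)
    (X : config R n) : {set {set 'I_n}} :=
  preim_partition (fun i => l (X i)) [set: 'I_n].

Definition changed (R : realType) (l : 'rV[R]_2 -> 'I_2) (n : nat)
    (X X' : config R n) : {set 'I_n} :=
  [set i | l (X' i) != l (X i)].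

(* Main.v *)
Require Import Defs.
From HB Require Import structures.
From mathcomp Require Import all_boot all_order all_algebra.
From mathcomp Require Import reals.
From mathcomp Require Import lra.

Set Implicit Arguments.
Unset Strict Implicit.
Unset Printing Implicit Defensive.

Import Order.TTheory GRing.Theory Num.Theory.
Local Open Scope ring_scope.

(** The instability comes from the bisector of the two centers, the vertical
    axis: the label of a point jumps when the point crosses that axis, however
    short the crossing is, and arbitrarily many points can sit next to it.
    Take [m.+1] copies of the point [(- eps / 2, 0)], which all receive the
    left center whatever the tie-breaking, and reflect all of them but the
    last to [(eps / 2, 0)].  Each point moves by at most [eps], and the [m]
    reflected points change center.  Reflecting all the points would only
    change the label of their common block; the point left behind prevents
    this, since it shared its block with the others and is now separated from
    them.  The labels come from [nearest_center_axis]; that a separated pair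
    makes the partitions differ is [eq_preim_partition_ker]. *)

Definition axis_point (R : realType) (t : R) : 'rV[R]_2 :=
  \row_(j < 2) (if j == 0 then t else 0).

Lemma axis_pointB (R : realType) (s t : R) :
  axis_point s - axis_point t = axis_point (s - t).
Proof. by apply/rowP => j; rewrite !mxE; case: eqP; rewrite ?subr0. Qed.

Lemma enorm_axis_point (R : realType) (t : R) : enorm (axis_point t) = `|t|.
Proof.
rewrite /enorm big_ord_recl big_ord1 !mxE /=.
by rewrite expr0n /= addr0 sqrtr_sqr.
Qed.

Lemma center_axis_point (R : realType) (k : 'I_2) :
  center R k = axis_point (if k == 0 then -1 else 1).
Proof. by []. Qed.

(** Off the bisector the nearest center is unique, so tie-breaking has no
    influence on the label. *)
Lemma nearest_center_axis (R : realType) (l : 'rV[R]_2 -> 'I_2) (t : R) :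
  nearest_center l -> t != 0 -> (l (axis_point t) == 0) = (t < 0).
Proof.
move=> hl t_neq0.
have := hl (axis_point t) (if t < 0 then 0 else 1).
rewrite !center_axis_point !axis_pointB !enorm_axis_point.
case: (ltgtP t 0) t_neq0 => // ht _; case: eqP => //= _;
  by case: (ger0P (t - 1)) => ?; case: (ger0P (t - -1)) => ? ?; lra.
Qed.

Lemma eq_preim_partition_ker (T : finType) (rT : eqType) (f g : T -> rT) (x y : T) :
  preim_partition f [set: T] = preim_partition g [set: T] ->
  (f x == f y) = (g x == g y).
Proof.
have equiv (h : T -> rT) : {in [set: T] & &, equivalence_rel [rel u v | h u == h v]}.
  by split=> //= /eqP ->.
move=> eq_fg.
have /= <- := pblock_equivalence_partition (equiv f) (in_setT x) (in_setT y).
have /= <- := pblock_equivalence_partition (equiv g) (in_setT x) (in_setT y).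
by rewrite -/(preim_partition f _) -/(preim_partition g _) eq_fg.
Qed.

Theorem proposition6p4 (R : realType) (l : 'rV[R]_2 -> 'I_2)
    (hl : nearest_center l) (eps : R) (heps : 0 < eps)
    (m : nat) (hm : (1 <= m)%N) :
  exists (n : nat) (X X' : config R n),
    [/\ (2 <= n)%N,
        config_dist X X' <= eps,
        (m <= #|changed l X X'|)%N
      & induced_partition l X' != induced_partition l X].
Proof.
pose a := axis_point (- (eps / 2)); pose b := axis_point (eps / 2).
have la : l a = 0 by apply/eqP; rewrite nearest_center_axis //; lra.
have lb : l b != 0 by rewrite nearest_center_axis //; lra.
exists m.+1, [ffun=> a], [ffun i => if i == ord_max then a else b].
split=> //.
- rewrite /config_dist; apply: bigmax_le => [|i _]; first exact: ltW.
  rewrite !ffunE; case: ifP => _; rewrite axis_pointB enorm_axis_point;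
    by rewrite ler_norml; apply/andP; split; lra.
- rewrite (_ : changed l _ _ = [set~ ord_max]) ?cardsC1 ?card_ord //.
  apply/setP=> i; rewrite !inE !ffunE la.
  by case: ifP => _ //=; rewrite la eqxx.
- apply/eqP => /(@eq_preim_partition_ker _ _ _ _ ord0 ord_max).
  rewrite !ffunE !eqxx la.
  (* [ord0] is one of the reflected indices because [m] is positive. *)
  have -> : (ord0 == ord_max :> 'I_m.+1) = false by rewrite -val_eqE /= ltn_eqF.
  by rewrite (negbTE lb).
Qed.
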